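(* If $X$ is an $\mathbb{N}$-compact space, then $C_c^K(X)=M_c^{\beta_0X\setminus X}$.
   Context: A space is $\mathbb{N}$-compact if it is homeomorphic to a closed subspace of $\mathbb{N}^\kappa$ for some cardinal $\kappa$, where $\mathbb{N}$ is discrete; such a space is zero-dimensional, i.e. Hausdorff with a base of clopen sets. For zero-dimensional $X$, $C_c(X)$ is the ring of all continuous functions $f:X\to\mathbb{R}$ with countable image; $Z(f)=\{x\in X: f(x)=0\}$. The Banaschewski compactification $\beta_0X$ is the (unique up to homeomorphism) compact zero-dimensional space containing $X$ as a dense subspace such that every continuous function $X\to\{0,1\}$ extends continuously to $\beta_0X$. The support of $f\in C_c(X)$ is $\mathrm{cl}_X(X\setminus Z(f))$, and $C_c^K(X)$ is the set of all $f\in C_c(X)$ with compact support. For $p\in\beta_0X$, $M_c^p=\{f\in C_c(X): p\in \mathrm{cl}_{\beta_0X}Z(f)\}$, and for $A\subseteq\beta_0X$, $M_c^A=\bigcap_{p\in A}M_c^p$ (equal to $C_c(X)$ when $A=\emptyset$). *)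

(* Defs.v *)
From HB Require Import structures.
From mathcomp Require Import all_boot all_order all_algebra.
From mathcomp Require Import all_classical all_reals.
From mathcomp Require Import topology normedtype.

Set Implicit Arguments.
Unset Strict Implicit.
Unset Printing Implicit Defensive.

Import Order.TTheory GRing.Theory Num.Theory.
Import numFieldNormedType.Exports.

Local Open Scope classical_set_scope.
Local Open Scope ring_scope.

Definition homeomorphic (X Y : topologicalType) : Prop :=
  exists (f : X -> Y) (g : Y -> X),
    [/\ continuous f, continuous g, cancel f g & cancel g f].

(* [F] is coerced to the subtype [set_type F], with the subspace topology. *)
Definition N_compact (X : topologicalType) : Prop :=
  exists (K : Type) (F : set {ptws K -> nat}),
    closed F /\ homeomorphic X F.

(* The library's [zero_dimensional] only asks that clopen sets separate points,
   which is weaker than having a clopen base outside the compact case. *)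
Definition zero_dimensional_space (X : topologicalType) : Prop :=
  hausdorff_space X /\ basis (@clopen X).

Definition embedding (X Y : topologicalType) (e : X -> Y) : Prop :=
  injective e /\ @open X = [set e @^-1` V | V in @open Y].

(* [(B, e)] is a model of beta_0 X, with X identified with [range e]. *)
Definition Banaschewski_compactification (X B : topologicalType) (e : X -> B)
  : Prop :=
  [/\ compact [set: B],
      zero_dimensional_space B,
      embedding e,
      dense (range e) &
      forall f : X -> bool, continuous f ->
        exists2 g : B -> bool, continuous g & forall x, g (e x) = f x].

Section countable_image.
Variables (R : realType) (X : topologicalType).

Definition Cc : set (X -> R) :=
  [set f | continuous f /\ countable (range f)].

Definition zero_set (f : X -> R) : set X := [set x | f x = 0].

Definition support (f : X -> R) : set X := closure (~` zero_set f).

Definition CcK : set (X -> R) := [set f | Cc f /\ compact (support f)].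

Variables (B : topologicalType) (e : X -> B).

Definition Mc (p : B) : set (X -> R) :=
  [set f | Cc f /\ closure (e @` zero_set f) p].

(* Intersecting with [Cc] only matters when [A] is empty, where a library
   [\bigcap] is the set of all functions. *)
Definition McI (A : set B) : set (X -> R) := Cc `&` \bigcap_(p in A) Mc p.

End countable_image.

Arguments Cc : clear implicits.
Arguments CcK : clear implicits.
Arguments Mc R {X B} e p.
Arguments McI R {X B} e A.

(* Main.v *)
Require Import Defs.
From HB Require Import structures.
From mathcomp Require Import all_boot all_order all_algebra.
From mathcomp Require Import all_classical all_reals.
From mathcomp Require Import topology normedtype.

(** Let [Z] be the zero set of [f] and [S] its support, and view [X] as a
    subspace of its Banaschewski compactification [B].

    If [S] is compact then it is closed in [B], and [X] is the union of [Z] and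
    [S]; since [X] is dense in [B], every point of [B] outside [X] lies in the
    closure of [Z] ([compact_support_closure_zero_set]).

    Conversely, suppose that the closure of [Z] in [B] contains all of
    [B \ X].  A closed subset of an N-compact space is compact as soon as every
    continuous [g : X -> nat] is bounded on it, because it then sits as a closed
    set in a product of finite sets ([N_compact_bounded_compact]).  So let [g]
    be unbounded on [S], hence on the cozero set [X \ Z].  Picking one small
    clopen set in each nonempty [g^-1(n) \ Z] and taking the union gives a set
    [C], clopen because the fibres of [g] form a clopen partition, disjoint from
    [Z], and on which [g] is still unbounded ([clopen_unbounded]).  The
    indicator function of [C] extends to [B], so the closures of [C] and [Z] in
    [B] are disjoint; the closure of [C] therefore stays inside [X], and [C]
    is compact ([clopen_disjoint_compact]).  This contradicts the
    unboundedness of [g] on [C]. *)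

Import numFieldNormedType.Exports.

Local Open Scope classical_set_scope.

Lemma embedding_continuous (X Y : topologicalType) (e : X -> Y) :
  embedding e -> continuous e.
Proof.
by move=> [_ oX]; apply/continuousP => V oV; rewrite oX; exists V.
Qed.

(** A cluster point in [K] of the image of a filter is some [e x], and the
    neighbourhoods of [x] are the traces of those of [e x].  The inclusion
    [K `<=` range e] is what makes this possible: preimages of compact sets
    under embeddings need not be compact. *)
Lemma embedding_compact_preimage (X Y : topologicalType) (e : X -> Y)
    (K : set Y) :
  embedding e -> compact K -> K `<=` range e -> compact (e @^-1` K).
Proof.
move=> [_ oX] Kcompact Ke F FF FK.
have [y [Ky Fy]] : K `&` cluster (e @ F) !=set0 by apply: Kcompact.
have [x _ xy] := Ke y Ky; exists x; split; first by rewrite /preimage/= xy.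
move=> A N FA; rewrite nbhsE => -[U [oU Ux] UN].
move: oU; rewrite oX => -[V oV VU].
have [||_ [[a Aa <-] Va]] := Fy (e @` A) V.
- by apply: (@filterS _ F _ A) => // a Aa; exists a.
- by apply: open_nbhs_nbhs; split=> //; rewrite -xy; move: Ux; rewrite -VU.
by exists a; split=> //; apply: UN; rewrite -VU.
Qed.

(** A clopen base of the ambient space restricts to one of the subspace. *)
Lemma embedding_clopen_nbhs (X Y : topologicalType) (e : X -> Y)
    (U : set X) (x : X) :
  embedding e -> basis (@clopen Y) -> open U -> U x ->
  exists C, [/\ clopen C, C x & C `<=` U].
Proof.
move=> eE [_ clB] oU Ux.
have ec := embedding_continuous _ _ _ eE.
case: eE => _ oX; move: oU; rewrite oX => -[V oV VU].
have [|D [[oD cD] Dx] DV] := clB (e x) V.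
  by apply: open_nbhs_nbhs; split=> //; move: Ux; rewrite -VU.
exists (e @^-1` D); split=> //.
- by split; [apply: open_comp | apply: closed_comp].
- by rewrite -VU => y /DV.
Qed.

(** A continuous function to a discrete space is locally constant, hence locally
    bounded, and local bounds over a compact set combine into one. *)
Lemma compact_nat_bounded (X : topologicalType) (K : set X) (g : X -> nat) :
  compact K -> continuous g -> exists b, forall x, K x -> (g x <= b)%N.
Proof.
move=> /compact_near_coveringP Kc gc.
have [x Kx|b _ /(_ b) /= Kb] := Kc nat \oo (fun n x => (g x <= n)%N) _.
  have gx : \forall y \near x, g y = g x.
    apply: (gc x [set g x]); apply: open_nbhs_nbhs; split=> //.
    exact: discrete_open.
  exists ([set y | g y = g x], [set n | (g x <= n)%N]) => /=.
    by split=> //; exists (g x).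
  by move=> [y n] [/= -> ].
exists b => x; exact: Kb.
Qed.

(** Replaces the subtype topology in the definition of N-compactness by a map,
    which is easier to compose with the coordinate projections. *)
Lemma N_compact_closed_embedding (X : topologicalType) :
  N_compact X -> exists (K : Type) (k : X -> {ptws K -> nat}),
    embedding k /\ closed (range k).
Proof.
move=> [K [F [cF [f [g [fc gc fK gK]]]]]].
have vc : continuous (set_val : F -> {ptws K -> nat}).
  exact: initial_continuous.
exists K, (set_val \o f); split; first split.
- by apply: inj_comp (can_inj fK); exact: val_inj.
- apply/seteqP; split=> [U oU | _ [V oV <-]].
    have : open (g @^-1` U) by apply: open_comp.
    move=> [V oV VU]; exists V => //.
    apply/seteqP; split=> x /=.
      move=> Vx; have : (g @^-1` U) (f x) by rewrite -VU.
      by rewrite /= fK.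
    by move=> Ux; have : (set_val @^-1` V) (f x) by rewrite VU /= fK.
  apply: open_comp oV => x _; apply: continuous_comp; [exact: fc|exact: vc].
suff -> : range (set_val \o f) = F by [].
apply/seteqP; split=> [_ [x _ <-] | y Fy]; first exact: set_valP.
exists (g (SigSub (mem_set Fy))) => //=.
by rewrite gK.
Qed.

(** Applied to the coordinates of a closed embedding of [X] in a power of [nat],
    the hypothesis places [S] inside a product of finite sets, which is compact
    by Tychonoff's theorem.  This is where N-compactness is used. *)
Lemma N_compact_bounded_compact (X : topologicalType) (S : set X) :
  N_compact X -> closed S ->
  (forall g : X -> nat, continuous g ->
    exists b, forall x, S x -> (g x <= b)%N) ->
  compact S.
Proof.
move=> /N_compact_closed_embedding[K [k [kE kcl]]] cS Sb.
have kc := embedding_continuous _ _ _ kE.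
(* Tychonoff's theorem and the continuity of projections are stated for index
   types with decidable equality, whence [{classic K}]. *)
have /choice [b bP] : forall i : K, exists b, forall x, S x -> (k x i <= b)%N.
  move=> i; apply: (Sb (fun x => k x i)) => x.
  apply: (@continuous_comp _ _ _ k (fun h : {ptws K -> nat} => h i)) => //.
    exact: kc.
  exact: (@proj_continuous {classic K} (fun=> nat) i).
pose Q : set {ptws K -> nat} := [set h | forall i, (h i <= b i)%N].
have Qc : compact Q.
  apply: (@tychonoff {classic K} (fun=> nat) (fun i => [set n | (n <= b i)%N])).
  move=> i; apply: finite_compact.
  by apply: sub_finite_set (finite_II (b i).+1).
apply: (@subclosed_compact _ _ (k @^-1` (Q `&` range k))) => //.
  apply: embedding_compact_preimage => //.
  exact: compact_closedI.
by move=> x Sx; split=> [i|]; [exact: bP | exists x].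
Qed.

Lemma clopen_continuous_bool (X : topologicalType) (C : set X) :
  clopen C -> continuous (fun x => `[< C x >]).
Proof.
move=> [oC cC]; apply/continuousP => A _.
have -> : (fun x => `[< C x >]) @^-1` A =
    \bigcup_(b in A) (if b then C else ~` C).
  apply/seteqP; split=> x /=.
    by move=> Ax; exists `[< C x >] => //; case: asboolP.
  by move=> [[] Ab] Cx; [rewrite asboolT|rewrite asboolF].
by apply: bigcup_open => -[] _ //; rewrite openC.
Qed.

Lemma zero_set_closed (R : realType) (X : topologicalType) (f : X -> R) :
  continuous f -> closed (zero_set f).
Proof.
move=> fc; have -> : zero_set f = f @^-1` [set 0%R] by [].
by apply: closed_comp => // x _; exact: fc.
Qed.

(** The image of the support is closed in [B], so a point outside the range
    that is a limit of the range must be a limit of the image of the zero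
    set. *)
Lemma compact_support_closure_zero_set (R : realType) (X B : topologicalType)
    (e : X -> B) (f : X -> R) (p : B) :
  hausdorff_space B -> continuous e -> dense (range e) ->
  compact (Defs.support f) -> ~ range e p -> closure (e @` zero_set f) p.
Proof.
move=> Bh ec ed fS pX.
have eS : closed (e @` Defs.support f).
  apply: compact_closed => //; apply: continuous_compact => //.
  exact: continuous_subspaceT.
have cover : range e `<=` e @` zero_set f `|` e @` Defs.support f.
  move=> _ [x _ <-]; have [xZ|xZ] := pselect (zero_set f x).
    by left; exists x.
  by right; exists x => //; exact: subset_closure.
have : closure (range e) p.
  move=> N; rewrite nbhsE => -[O [oO Op] ON].
  have [|y [Oy ey]] := ed O _ oO; first by exists p.
  by exists y; split=> //; exact: ON.
move=> /(closureS cover); rewrite closureU => -[//|].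
by rewrite -(closure_id _).1// => -[x _ xp]; case: pX; exists x.
Qed.

(** The extension to [B] of the indicator function of [C] equals [false] on
    the closure of the image of [Z], hence at every point outside the range of
    [e].  Its fibre over [true] is thus a compact subset of the range, whose
    trace on [X] is [C]. *)
Lemma clopen_disjoint_compact (X B : topologicalType) (e : X -> B) (Z C : set X) :
  Banaschewski_compactification e -> clopen C -> C `&` Z = set0 ->
  ~` range e `<=` closure (e @` Z) -> compact C.
Proof.
move=> [Bc _ eE _ ext] cC CZ0 eZ.
have [G Gc Ge] := ext _ (clopen_continuous_bool _ _ cC).
have clG b : closed (G @^-1` [set b]).
  by apply: closed_comp; [move=> x _; exact: Gc|exact: discrete_closed].
have -> : C = e @^-1` (G @^-1` [set true]).
  apply/seteqP; split=> x; rewrite /preimage/= Ge; first by move/asboolT.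
  by move/asboolW.
apply: embedding_compact_preimage => //.
  exact: subclosed_compact Bc _.
move=> y /= Gy; apply: contrapT => /eZ yZ.
suff : (G @^-1` [set false]) y by rewrite /= Gy.
have /closure_id -> := clG false.
apply: closureS yZ => _ [x Zx <-] /=; rewrite Ge; apply: asboolF => Cx.
by have : (C `&` Z) x by []; rewrite CZ0.
Qed.

(** A union of clopen sets need not be closed, but one that picks a single
    clopen set [D n] inside each fibre of [g] is: its complement is the union of
    the open sets [g^-1(n) \ D n]. *)
Lemma clopen_unbounded (X : topologicalType) (U : set X) (g : X -> nat) :
  (forall x, U x -> exists C, [/\ clopen C, C x & C `<=` U]) ->
  continuous g -> (forall b, exists2 x, U x & (b < g x)%N) ->
  exists C, [/\ clopen C, C `<=` U & forall b, exists2 x, C x & (b < g x)%N].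
Proof.
move=> Ucl gc Ug.
have gcl n : clopen (g @^-1` [set n]).
  split; [apply: open_comp; last exact: discrete_open
         |apply: closed_comp; last exact: discrete_closed] => x _; exact: gc.
have /choice[D DP] : forall n, exists D : set X, [/\ clopen D, D `<=` U,
    D `<=` g @^-1` [set n] & U `&` g @^-1` [set n] !=set0 -> D !=set0].
  move=> n; have [[x [Ux gx]]|Un] := pselect (U `&` g @^-1` [set n] !=set0).
    have [C [cC Cx CU]] := Ucl x Ux; exists (C `&` g @^-1` [set n]); split.
    - exact: clopenI.
    - by move=> y [/CU].
    - by move=> y [].
    - by exists x.
  by exists set0; split=> //; split; [exact: open0|exact: closed0].
pose C := \bigcup_n D n.
have CD x : C x <-> D (g x) x.
  split=> [[n _ Dx]|Dx]; last by exists (g x).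
  by have [_ _ Dg _] := DP n; rewrite (Dg x Dx).
exists C; split.
- split; first by apply: bigcup_open => n _; have [[]] := DP n.
  rewrite -openC.
  have -> : ~` C = \bigcup_n (~` D n `&` g @^-1` [set n]).
    apply/seteqP; split=> [x Cx|x [n _ [Dx gx]]].
      by exists (g x) => //; split=> // Dx; apply: Cx; apply/CD.
    by move=> /CD; rewrite gx.
  apply: bigcup_open => n _; apply: openI; last by case: (gcl n).
  by rewrite openC; have [[]] := DP n.
- by move=> x [n _]; have [_ DU _ _] := DP n; exact: DU.
- move=> b; have [x Ux bx] := Ug b.
  have [_ _ Dg [|y Dy]] := DP (g x); first by exists x.
  by exists y; [exists (g x)|rewrite (Dg y Dy)].
Qed.

Theorem corollary2p13 (R : realType) (X B : topologicalType) (e : X -> B)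
    (hX : N_compact X) (hB : Banaschewski_compactification e) :
  CcK R X = McI R e (~` range e).
Proof.
have [_ [Bh Bb] eE ed _] := hB.
apply/seteqP; split=> f.
  move=> [fC fS]; split=> // p pX; split=> //.
  apply: compact_support_closure_zero_set => //; exact: embedding_continuous.
move=> [fC fM]; split=> //; have [fc _] := fC.
apply: N_compact_bounded_compact => //; first exact: closed_closure.
(* A bound on the cozero set is inherited by its closure, the support. *)
move=> g gc; suff [b gb] : exists b, ~` zero_set f `<=` [set x | (g x <= b)%N].
  exists b => x /(closureS gb); rewrite -(closure_id _).1 //.
  have -> : [set x | (g x <= b)%N] = g @^-1` [set n | (n <= b)%N] by [].
  by apply: closed_comp; [move=> y _; exact: gc|exact: discrete_closed].
apply: contrapT => unb.
have [|b|C [cC CU Cg]] := clopen_unbounded _ (~` zero_set f) g _ gc.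
- move=> x fx; apply: embedding_clopen_nbhs eE Bb _ fx.
  by rewrite openC; exact: zero_set_closed.
- apply: contrapT => Hb; apply: unb; exists b => x fx /=.
  by rewrite leqNgt; apply/negP => bx; apply: Hb; exists x.
have Cc : compact C.
  apply: (clopen_disjoint_compact _ _ _ (zero_set f) _ hB cC) => [|p pX].
    by apply/seteqP; split=> // x [/CU].
  by have [] := fM p pX.
have [b gb] := compact_nat_bounded _ _ _ Cc gc.
have [x Cx] := Cg b.
by rewrite ltnNge gb.
Qed.
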